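(* Let $R = k[x_1,\dots,x_n]$ be a polynomial ring over a field $k$. Let $I$ be a nonzero monomial ideal in $R$ and $x$ a variable of $R$ (one of $x_1,\dots,x_n$). Then $$\max\{\operatorname{reg}(I:x),\ \operatorname{reg}(I,x)\} \le \operatorname{reg} I \le \max\{\operatorname{reg}(I:x)+1,\ \operatorname{reg}(I,x)\}.$$
   Context: $R$ has the standard grading and $\mathfrak m=(x_1,\dots,x_n)$. For a finitely generated graded $R$-module $M$ with local cohomology modules $H^i_{\mathfrak m}(M)$, $\operatorname{reg} M := \max\{i+j \mid H^i_{\mathfrak m}(M)_j \neq 0\}$ (Castelnuovo-Mumford regularity); here ideals are regarded as graded $R$-modules. $I:x=\{g\in R\mid gx\in I\}$ and $(I,x)=I+(x)$. *)

(* Defs.v *)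
From mathcomp Require Import all_boot all_order all_algebra.
From mathcomp Require Import mpoly.
From Stdlib Require Import ClassicalEpsilon.

Set Implicit Arguments.
Unset Strict Implicit.
Unset Printing Implicit Defensive.

Import Order.TTheory GRing.Theory Num.Theory.
Local Open Scope ring_scope.

(* A graded module N over R = k[X_0, ..., X_(n-1)] is given by its homogeneous
   components N j (j : int), viewed as subsets of an ambient R-module M: N is
   the (direct) sum of the N j. Local cohomology with support in
   (X_0, ..., X_(n-1)) is defined as the cohomology of the Cech complex
     0 -> N -> (+)_i N_(X_i) -> (+)_(i < l) N_(X_i X_l) -> ...
       -> N_(X_0 ... X_(n-1)) -> 0.
   Its p-th term is the sum, over the S of cardinality p, of the localizations
   of N at xprod S. Since this sum is finite, a p-cochain can be written with a
   common exponent, as (c S / xprod S ^+ a)_S; only the values of c on the sets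
   of cardinality p matter. *)
Section CechCohomology.

Variables (k : fieldType) (n : nat) (M : lmodType {mpoly k[n]}).
Implicit Types (S T : {set 'I_n}) (c e : {set 'I_n} -> M) (N : int -> M -> Prop).

Definition xprod S : {mpoly k[n]} := \prod_(i in S) 'X_i.

(* u / xprod S ^+ a = v / xprod S ^+ b in the localization at xprod S *)
Definition frac_eq S (u : M) (a : nat) (v : M) (b : nat) : Prop :=
  exists t : nat,
    xprod S ^+ t *: (xprod S ^+ b *: u - xprod S ^+ a *: v) = 0.

(* homogeneous of degree j: c S / xprod S ^+ a has degree deg (c S) - a * #|S| *)
Definition cech_cochain N (p : nat) (j : int) (a : nat) c : Prop :=
  forall S, #|S| = p -> N (j + (a * p)%:Z) (c S).

(* numerator, over xprod T ^+ a, of the T-component of the differential; the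
   image of m / xprod (T :\ i) ^+ a in the localization at xprod T is
   ('X_i ^+ a *: m) / xprod T ^+ a *)
Definition cech_diff (a : nat) c T : M :=
  \sum_(i in T)
    (-1) ^+ #|[set l in T | (l < i)%N]| *: ('X_i ^+ a *: c (T :\ i)).

Definition cech_cocycle (p a : nat) c : Prop :=
  forall T, #|T| = p.+1 -> frac_eq T (cech_diff a c T) a 0 0.

Definition cech_coboundary N (p : nat) (j : int) (a : nat) c : Prop :=
  match p with
  | 0 => forall S, #|S| = 0%N -> frac_eq S (c S) a 0 0
  | q.+1 => exists (b : nat) e, cech_cochain N q j b e /\
      forall S, #|S| = q.+1 -> frac_eq S (c S) a (cech_diff b e S) b
  end.

(* the component of degree j of the p-th local cohomology of N is nonzero *)
Definition local_cohomology_neq0 N (p : nat) (j : int) : Prop :=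
  exists (a : nat) c, [/\ cech_cochain N p j a c, cech_cocycle p a c
                        & ~ cech_coboundary N p j a c].

Definition is_reg N (r : int) : Prop :=
  (exists (i : nat) (j : int), local_cohomology_neq0 N i j /\ r = i%:Z + j) /\
  (forall (i : nat) (j : int), local_cohomology_neq0 N i j -> i%:Z + j <= r).

(* Castelnuovo-Mumford regularity; the value is arbitrary when the maximum does
   not exist, which does not happen for finitely generated nonzero N *)
Definition reg N : int := epsilon (inhabits 0) (is_reg N).

Lemma regE N (r : int) : is_reg N r -> reg N = r.
Proof.
move=> Nr; have [[i [j [Hij ->]]] ub] : is_reg N (reg N).
  by apply: epsilon_spec; exists r.
have [[i' [j' [Hij' rE]]] ub'] := Nr.
by apply/le_anti; rewrite ub' //= rE ub.
Qed.

End CechCohomology.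

Section Ideals.

Variables (k : fieldType) (n : nat).
Local Notation R := {mpoly k[n]}.
Implicit Types (I J : R -> Prop) (f g h x : R).

Definition is_ideal I : Prop :=
  [/\ I 0, forall f g, I f -> I g -> I (f + g)
    & forall h f, I f -> I (h * f)].

Definition ideal_gen (G : R -> Prop) : R -> Prop :=
  fun f => forall J, is_ideal J -> (forall g, G g -> J g) -> J f.

Definition monomial_ideal I : Prop :=
  exists A : 'X_{1..n} -> Prop,
    forall f, I f <-> ideal_gen (fun g => exists2 m, A m & g = 'X_[m]) f.

Definition colon_ideal I x : R -> Prop := fun g => I (g * x).

Definition principal_ideal x : R -> Prop := fun f => exists h, f = h * x.

Definition ideal_sum I J : R -> Prop :=
  fun f => exists g h, [/\ I g, J h & f = g + h].

(* the components of the ideal I, as a graded submodule of R with the standard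
   grading *)
Definition ideal_component I (j : int) (f : R^o) : Prop :=
  I f /\ {in msupp (f : R), forall m, (mdeg m)%:Z = j}.

Definition reg_ideal I : int := reg (ideal_component I).

End Ideals.

(* Main.v *)
Require Import Defs.
From mathcomp Require Import all_boot all_order all_algebra.
From mathcomp Require Import mpoly zify ring.
From Stdlib Require Import Classical ClassicalEpsilon.

(** The Cech complex of a monomial ideal [I] is graded by Z^n, not only by Z,
    and each multidegree is a finite combinatorial problem. Let [E] be the set
    of exponents of the monomials of [I]. In multidegree [u], the localization
    of [I] at the product of the variables in [S] is a copy of [k] when [S]
    lies in
      F_u(I) = { S | some m in E has m_l <= u_l for all l not in S },
    and is zero otherwise. Hence H^p(I)_u is the cohomology, at the sets of
    cardinality p, of the complex of k-valued functions supported on the upward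
    closed family F_u(I), and reg I is the maximum of p + |u| over the pairs
    (p, u) for which this cohomology is nonzero. This translation is
    [local_cohomology_of_degree] and [degree_of_local_cohomology].

    The maximum exists. By Dickson's lemma, membership of m in [E] does not
    change when the coordinates of m are truncated at some constant d; if
    u_l >= d then F_u(I) is stable under removal of l, so its complex is a
    cone and has no cohomology. Hence only u with all coordinates below d
    count ([reg_value_le]). The multidegree (-1, ..., -1) does contribute, at
    p = n ([reg_value_ex]).

    It remains to compare families, for x = x_i.
    - Colon: F_u(I : x) is F_u(I) if u_i < 0, and F_(u + e_i)(I) if u_i >= 0.
      So each value p + |u| for I : x occurs for I, possibly increased by 1,
      and each value for I with u_i <> 0 occurs for I : x, possibly decreased
      by 1.
    - Sum: if u_i <> 0, then F_u(I, x) is either acyclic or equal to F_u(I).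
      If u_i = 0, the families F_u(I) and F_u(I, x) agree on the sets without
      i, and the members of F_u(I) that contain i form F_(u - e_i)(I), which
      is also F_(u - e_i)(I : x). If every other coordinate of u is negative,
      the two families are equal; otherwise the members of F_u(I, x) that
      contain i form an acyclic family. The long exact sequences of the
      restriction to the sets without i then link the cohomologies of F_u(I),
      F_u(I, x) and F_(u - e_i)(I) ([acyclic_of_larger],
      [acyclic_of_smaller]). For the bound on reg (I, x), the shift of u by
      -e_i is compensated by the shift of p by 1 in the connecting map; for
      the upper bound on reg I, it accounts for the + 1. *)

Set Implicit Arguments.
Unset Strict Implicit.
Unset Printing Implicit Defensive.

Import Order.TTheory GRing.Theory Num.Theory.
Local Open Scope ring_scope.

(** * Cochain complexes of families of subsets *)

Section SetComplex.

Variables (k : fieldType) (n : nat).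
Implicit Types (S T : {set 'I_n}) (i l : 'I_n) (f g h : {set 'I_n} -> k)
  (F G : {set 'I_n} -> Prop).

Definition sgn T i : k := (-1) ^+ #|[set l in T | (l < i)%N]|.

Definition delta f T : k := \sum_(i in T) sgn T i * f (T :\ i).

Definition upset F : Prop := forall S T, S \subset T -> F S -> F T.

Definition supported F p f : Prop := forall S, #|S| = p -> f S <> 0 -> F S.

Definition cocycle p f : Prop := forall T, #|T| = p.+1 -> delta f T = 0.

(** For p = 0 the primitive g is unconstrained, but then [delta g] at the empty
    set is an empty sum, so a coboundary is zero in cardinality 0. *)
Definition coboundary F p f : Prop :=
  exists2 g, (forall q, p = q.+1 -> supported F q g)
           & forall S, #|S| = p -> f S = delta g S.

(** Exactness at the sets of cardinality p of the subcomplex of the functions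
    supported on F (a subcomplex when F is an upset). *)
Definition acyclic_at F p : Prop :=
  forall f, supported F p f -> cocycle p f -> coboundary F p f.

Lemma sgnK T i : sgn T i * sgn T i = 1.
Proof. by rewrite /sgn -expr2 sqrr_sign. Qed.

Lemma sgnU1 S i l : i \notin S -> sgn (i |: S) l = (-1) ^+ (i < l)%N * sgn S l.
Proof.
move=> iS; rewrite /sgn -exprD; congr (_ ^+ _).
case: ltnP => il; last first.
  rewrite add0n; apply: eq_card => x; rewrite !inE.
  by case: eqP => [->|] //; rewrite ltnNge il !andbF.
transitivity #|i |: [set x in S | (x < l)%N]|; last first.
  by rewrite cardsU1 !inE (negPf iS).
by apply: eq_card => x; rewrite !inE; case: eqP => [->|].
Qed.

Lemma sgn_swap i l : i != l -> (-1) ^+ (i < l)%N * (-1) ^+ (l < i)%N = -1 :> k.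
Proof.
rewrite -val_eqE /= => /eqP il.
by case: (ltngtP i l) => // _; rewrite ?mulr1 ?mul1r.
Qed.

Lemma eq_delta f g T :
  (forall i, i \in T -> f (T :\ i) = g (T :\ i)) -> delta f T = delta g T.
Proof. by move=> fg; apply: eq_bigr => i iT; rewrite fg. Qed.

Lemma deltaD f g T : delta (fun S => f S + g S) T = delta f T + delta g T.
Proof. by rewrite -big_split; apply: eq_bigr => i _; rewrite mulrDr. Qed.

Lemma deltaB f g T : delta (fun S => f S - g S) T = delta f T - delta g T.
Proof. by rewrite -sumrB; apply: eq_bigr => i _; rewrite mulrBr. Qed.

(** The terms are paired by i < l against l < i, rather than shown equal to
    their opposite, so that characteristic 2 is covered. *)
Lemma antisym_sum (V : zmodType) T (u : 'I_n -> 'I_n -> V) :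
    (forall i l, i \in T -> l \in T -> i != l -> u i l = - u l i) ->
  \sum_(i in T) \sum_(l in T :\ i) u i l = 0.
Proof.
move=> uN; transitivity (\sum_(i in T) \sum_(l in T | (l < i)%N) u i l
                       + \sum_(i in T) \sum_(l in T | (i < l)%N) u i l).
  rewrite -big_split; apply: eq_bigr => i iT /=.
  rewrite (bigID (fun l : 'I_n => (l < i)%N)) /=; congr (_ + _);
    apply: eq_bigl => l; rewrite !inE -val_eqE /=;
    by case: (ltngtP l i); rewrite ?andbT ?andbF.
rewrite [X in _ + X](exchange_big_dep (fun l => l \in T)) /=; last first.
  by move=> ? ? _ /andP[].
rewrite -big_split big1 //= => i iT.
rewrite [X in _ + X](eq_bigl (fun l => (l \in T) && (l < i)%N)); last first.
  by move=> l; rewrite /= iT.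
rewrite -big_split big1 //= => l.
by case/andP=> lT li; rewrite (uN i l) ?addNr // -val_eqE neq_ltn li orbT.
Qed.

Lemma delta_delta f T : delta (delta f) T = 0.
Proof.
rewrite /delta; under eq_bigr do rewrite mulr_sumr.
apply: antisym_sum => i l iT lT il.
have sE x y : x \in T -> y \in T -> x != y ->
    sgn T x = (-1) ^+ (y < x)%N * sgn (T :\ y) x.
  by move=> xT yT xy; rewrite -sgnU1 ?setD1K // !inE eqxx.
rewrite (sE i l) // (sE l i) 1?eq_sym // setDDl setUC -setDDl.
rewrite -[RHS]mulN1r -(sgn_swap il).
move: (sgn _ _) (sgn _ _) (f _) => a b c.
case: (i < l)%N (l < i)%N => [] [] /=; ring.
Qed.

Lemma cocycle_delta p f g :
  (forall S, #|S| = p -> f S = delta g S) -> cocycle p f.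
Proof.
move=> fE T cT; rewrite -(delta_delta g T); apply: eq_delta => i iT.
by apply: fE; move: cT; rewrite (cardsD1 i) iT => -[].
Qed.

Lemma cocycleB p f g :
  cocycle p f -> cocycle p g -> cocycle p (fun S => f S - g S).
Proof. by move=> cf cg T cT; rewrite deltaB cf ?cg ?subrr. Qed.

Definition contract i f S : k :=
  if i \in S then 0 else sgn (i |: S) i * f (i |: S).

(** Contracting along i is a homotopy from the identity to 0 on all functions
    on subsets; it restricts to the families that are stable under removal of
    i. *)
Lemma contractP i f S : delta (contract i f) S + contract i (delta f) S = f S.
Proof.
rewrite {2}/contract; have [iS|iS] := boolP (i \in S).
  rewrite addr0 /delta (bigD1 i) //= big1 ?addr0 => [|l /andP[lS li]].
    by rewrite /contract !inE eqxx /= setD1K // mulrA sgnK mul1r.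
  by rewrite /contract !inE eq_sym li iS mulr0.
rewrite {2}/delta big_setU1 //= mulrDr mulrA sgnK mul1r setU1K //.
rewrite addrCA mulr_sumr -big_split /= big1 ?addr0 // => l lS.
have il : i != l by apply: contraNneq iS => ->.
rewrite /contract !inE (negPf iS) andbF.
have -> : i |: S :\ l = (i |: S) :\ l.
  by apply/setP=> x; rewrite !inE; case: eqP => [->|//]; rewrite il.
have e1 : sgn (i |: S) i = (-1) ^+ (l < i)%N * sgn ((i |: S) :\ l) i.
  by rewrite -sgnU1 ?setD1K ?inE ?eqxx ?lS ?orbT.
rewrite !mulrA -mulrDl e1 sgnU1 //.
have -> : sgn S l * sgn ((i |: S) :\ l) i +
   (-1) ^+ (l < i)%N * sgn ((i |: S) :\ l) i * ((-1) ^+ (i < l)%N * sgn S l) =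
   (1 + (-1) ^+ (i < l)%N * (-1) ^+ (l < i)%N) *
   (sgn S l * sgn ((i |: S) :\ l) i).
  by ring.
by rewrite sgn_swap // subrr !mul0r.
Qed.

Lemma contract_coboundary F p i f :
    (forall S, #|S| = p -> i \in S -> f S <> 0 -> F (S :\ i)) -> cocycle p f ->
  coboundary F p f.
Proof.
move=> Ff cf; exists (contract i f) => [q pE S cS|S cS].
  rewrite /contract; case: ifPn => // iS hS.
  rewrite -(setU1K iS); apply: Ff; rewrite ?cardsU1 ?iS ?cS ?inE ?eqxx //.
  by move=> f0; apply: hS; rewrite f0 mulr0.
rewrite -[LHS](contractP i) [X in _ + X](_ : _ = 0) ?addr0 // /contract.
by case: ifPn => // iS; rewrite cf ?mulr0 // cardsU1 iS cS.
Qed.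

Lemma cone_acyclic F p i : (forall S, F S -> F (S :\ i)) -> acyclic_at F p.
Proof.
by move=> Fi f Ff; apply: (@contract_coboundary _ _ i) => S cS iS /(Ff _ cS)/Fi.
Qed.

Lemma eq_acyclic F G p :
  (forall S, F S <-> G S) -> acyclic_at F p -> acyclic_at G p.
Proof.
move=> FG aF f Gf cf; have [|g Fg gE] := aF f _ cf.
  by move=> S cS /(Gf S cS)/FG.
by exists g => // q pE S cS /(Fg q pE S cS)/FG.
Qed.

Lemma not_acyclicP F p :
  ~ acyclic_at F p <->
  exists f, [/\ supported F p f, cocycle p f & ~ coboundary F p f].
Proof.
split=> [nF|[f [Ff cf nf]] aF]; last exact/nf/aF.
apply: NNPP => nex; apply: nF => f Ff cf; apply: NNPP => nf.
by apply: nex; exists f.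
Qed.

Lemma deltaN0 f T : delta f T <> 0 -> exists2 i, i \in T & f (T :\ i) <> 0.
Proof.
move=> nz; apply: NNPP => nex; apply: nz; apply: big1 => i iT.
have [->|/eqP fN0] := eqVneq (f (T :\ i)) 0; first by rewrite mulr0.
by case: nex; exists i.
Qed.

Lemma cardsD1P T i p : #|T| = p.+1 -> i \in T -> #|T :\ i| = p.
Proof. by move=> cT iT; move: cT; rewrite (cardsD1 i) iT => -[]. Qed.

Lemma card_setS T p i : #|T| = p -> i \in T -> exists q, p = q.+1.
Proof. by move=> <- iT; rewrite (cardsD1 i) iT; exists #|T :\ i|. Qed.

Definition restrict_off i f S : k := if i \in S then 0 else f S.

Lemma supported_restrict_off F G i p f :
    (forall S, i \notin S -> F S -> G S) -> supported F p f ->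
  supported G p (restrict_off i f).
Proof.
move=> FG Ff S cS; rewrite /restrict_off.
by case: ifPn => // iS /(Ff _ cS)/FG; apply.
Qed.

Lemma delta_restrict_off i f T :
  delta (restrict_off i f) T =
    if i \in T then sgn T i * f (T :\ i) else delta f T.
Proof.
case: ifPn => iT; last first.
  by apply: eq_delta => l lT; rewrite /restrict_off !inE (negPf iT) andbF.
rewrite /delta (bigD1 i) //= big1 ?addr0 => [|l /andP[lT li]].
  by rewrite /restrict_off !inE eqxx.
by rewrite /restrict_off !inE eq_sym li iT mulr0.
Qed.

(** If F is an upset, the functions supported on the members of F that contain
    i form a subcomplex, and restriction to the sets without i is the quotient
    map. F and G below have the same quotient, so the two long exact sequences
    compare their cohomologies. *)
Section Link.

Variables (F G : {set 'I_n} -> Prop) (i : 'I_n).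
Hypothesis F_upset : upset F.
Hypothesis F_sub_G : forall S, F S -> G S.
Hypothesis G_sub_F : forall S, i \notin S -> G S -> F S.

Let L S := i \in S /\ F S.

(** The cohomology of F maps to that of G; the restriction to the sets without
    i of a G-primitive is supported on F, and differs from a primitive on F by
    a cocycle on the members of F that contain i. *)
Lemma acyclic_of_larger p : acyclic_at G p -> acyclic_at L p -> acyclic_at F p.
Proof.
move=> aG aL f Ff cf; have [S cS /(Ff _ cS)/F_sub_G //|g Gg gE] := aG f _ cf.
have Fg q : p = q.+1 -> supported F q (restrict_off i g).
  by move=> /Gg; apply: supported_restrict_off.
have [S cS nz|| h Lh hE] := aL (fun S => f S - delta (restrict_off i g) S).
- split.
    apply: contraPT nz => iS; rewrite delta_restrict_off (negPf iS) gE //.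
    by rewrite subrr; apply.
  have [f0|/eqP fN0] := eqVneq (f S) 0; last exact: (Ff S).
  move: nz; rewrite f0 sub0r => /eqP; rewrite oppr_eq0 => /eqP/deltaN0[l lS].
  have [q pE] := card_setS cS lS.
  move/(Fg q pE _ (cardsD1P (etrans cS pE) lS)).
  exact/F_upset/subsetDl.
- by apply: cocycleB => //; apply: cocycle_delta.
exists (fun S => restrict_off i g S + h S) => [q pE S cS|S cS].
  have [-> |/eqP gN0 _] := eqVneq (restrict_off i g S) 0; last exact: (Fg q).
  by rewrite add0r => /(Lh q pE S cS)[].
by rewrite deltaD -hE // addrC subrK.
Qed.

(** A cocycle f on G is restricted to the sets without i; the coboundary of the
    restriction is a cocycle on the members of F that contain i, one
    cardinality higher (the connecting map). Once this obstruction is killed,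
    f agrees off i with a coboundary on F, and the difference lives on the
    members of G that contain i, where contraction along l applies. *)
Lemma acyclic_of_smaller p l :
    (forall S, i \in S -> G S -> G (S :\ l)) ->
  acyclic_at F p -> acyclic_at L p.+1 -> acyclic_at G p.
Proof.
move=> Gl aF aL f Gf cf.
have Ff : supported F p (restrict_off i f) by apply: supported_restrict_off Gf.
have [S cS nz||h Lh hE] := aL (delta (restrict_off i f)).
- move: nz; rewrite delta_restrict_off.
  case: ifPn => [iS nz|_]; last by rewrite cf.
  split=> //; apply: (@F_upset (S :\ i)); first exact: subsetDl.
  apply: G_sub_F; first by rewrite !inE eqxx.
  by apply: (Gf _ (cardsD1P cS iS)) => f0; apply: nz; rewrite f0 mulr0.
- exact: cocycle_delta.
have [S cS nz||g Fg gE] := aF (fun S => restrict_off i f S - h S).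
- have [f0|/eqP fN0] := eqVneq (restrict_off i f S) 0; last exact: (Ff S).
  suff /(Lh p erefl S cS)[]: h S <> 0 by [].
  by move=> h0; apply: nz; rewrite f0 h0 subrr.
- by move=> T cT; rewrite deltaB hE ?subrr.
have iP S : #|S| = p -> i \notin S -> f S = delta g S.
  move=> cS iS; rewrite -gE // /restrict_off (negPf iS).
  have [->|/eqP] := eqVneq (h S) 0; first by rewrite subr0.
  by case/(Lh p erefl S cS) => iS'; rewrite iS' in iS.
have [S cS lS nz||e Ge eE] :=
  @contract_coboundary G p l (fun S => f S - delta g S).
- have iS : i \in S by apply: contraPT nz => iS; rewrite iP // subrr; apply.
  apply: Gl => //; have [f0|/eqP fN0] := eqVneq (f S) 0; last exact: (Gf S).
  move: nz; rewrite f0 sub0r => /eqP; rewrite oppr_eq0 => /eqP/deltaN0[x xS].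
  have [q pE] := card_setS cS xS.
  move/(Fg q pE _ (cardsD1P (etrans cS pE) xS)).
  by move/(F_upset (subD1set _ _))/F_sub_G.
- by apply: cocycleB => //; apply: cocycle_delta.
exists (fun S => g S + e S) => [q pE S cS|S cS].
  have [-> |/eqP gN0 _] := eqVneq (g S) 0; last exact/F_sub_G/(Fg q).
  by rewrite add0r => /(Ge q pE S cS).
by rewrite deltaD -eE // addrC subrK.
Qed.

End Link.

End SetComplex.

(** * Truncation of monomial exponents *)

(** Dickson's lemma in the form of a finite bound: U depends only on the first r
    coordinates and is upward closed, and membership survives truncation at d.
    The slices of U at coordinate r increase with the value t of that
    coordinate. The induction hypothesis for their union W reduces W to
    finitely many points, so the union is reached at some stage t0; the
    finitely many slices up to t0 are bounded by the induction hypothesis. *)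
Lemma dickson_truncation r (U : (nat -> nat) -> Prop) :
    (forall m m', (forall i, (i < r)%N -> (m i <= m' i)%N) -> U m -> U m') ->
  exists d, forall m, U m -> U (fun i => minn (m i) d).
Proof.
elim: r U => [|r IHr] U monoU.
  by exists 0%N => m; apply: monoU.
pose slice t m := U (fun i => if i == r then t else m i).
have mono_slice t t' m m' : (t <= t')%N ->
    (forall i, (i < r)%N -> (m i <= m' i)%N) -> slice t m -> slice t' m'.
  move=> tt' mm'; apply: monoU => i; rewrite ltnS leq_eqVlt.
  by case: eqP => //= _; apply: mm'.
pose W m := exists t, slice t m.
have [d dW] : exists d, forall m, W m -> W (fun i => minn (m i) d).
  apply: IHr => m m' mm' [t Wt]; exists t; exact: mono_slice Wt.
pose box (x : {ffun 'I_r -> 'I_d.+1}) i :=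
  if insub i is Some j then val (x j) else 0%N.
have [T TP] : exists T : {ffun 'I_r -> 'I_d.+1} -> nat,
    forall x, W (box x) -> slice (T x) (box x).
  apply: (@fin_all_exists _ (fun=> nat)
    (fun x t => W (box x) -> slice t (box x))).
  move=> x; have [[t Wt]|nW] := classic (W (box x)); first by exists t.
  by exists 0%N.
pose t0 := (\max_x T x)%N.
have [D DP] : exists D : 'I_t0.+1 -> nat, forall (t : 'I_t0.+1) m,
    slice t m -> slice t (fun i => minn (m i) (D t)).
  apply: (@fin_all_exists _ (fun=> nat) (fun (t : 'I_t0.+1) D => forall m,
    slice t m -> slice t (fun i => minn (m i) D))) => t.
  by apply: IHr => m m'; apply: mono_slice.
pose b := maxn (maxn d t0) (\max_t D t)%N; exists b => m Um.
have to_U t m' : (t <= minn (m r) b)%N ->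
    (forall i, (i < r)%N -> (m' i <= minn (m i) b)%N) -> slice t m' ->
    U (fun i => minn (m i) b).
  move=> tm mm'; apply: monoU => i; rewrite ltnS leq_eqVlt.
  by case: eqP => [->|] //= _; apply: mm'.
have slice_m : slice (m r) m by apply: monoU Um => i _; case: eqP => [->|].
have [mr|mr] := leqP (m r) t0.
  apply: (to_U _ _ _ _ (DP (Ordinal (mr : (m r < t0.+1)%N)) _ slice_m)) => /=.
    by rewrite leq_min leqnn /b; lia.
  move=> i _; rewrite leq_min geq_minl /b (leq_trans (geq_minr _ _)) //.
  by rewrite leq_max (leq_bigmax (F := D)) orbT.
pose x := [ffun j : 'I_r => inord (minn (m j) d) : 'I_d.+1].
have boxE i : (i < r)%N -> box x i = minn (m i) d.
  move=> ir; rewrite /box insubT /= ffunE inordK // ltnS; exact: geq_minr.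
have : W (box x).
  have [t Wt] := dW m (ex_intro (slice^~ m) _ slice_m).
  by exists t; apply: mono_slice Wt => // i ir; rewrite boxE.
move/TP; apply: to_U => [|i ir].
  have : (T x <= t0)%N by apply: leq_bigmax.
  by rewrite leq_min /b; lia.
by rewrite boxE // /b; lia.
Qed.

Section DegreeFamily.

Variables (k : fieldType) (n : nat).
Implicit Types (E : 'X_{1..n} -> Prop) (m : 'X_{1..n})
  (u v : {ffun 'I_n -> int}) (S T : {set 'I_n}) (i l : 'I_n).

Definition exp_ideal E := forall m m', (m <= m')%MM -> E m -> E m'.

Definition truncates E d := forall m, E m -> E [multinom minn (m l) d | l < n].

Lemma exp_ideal_truncates E : exp_ideal E -> exists d, truncates E d.
Proof.
move=> upE; pose U (f : nat -> nat) := E [multinom f l | l < n].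
have [|d dP] := @dickson_truncation n U.
  move=> f f' ff'; apply: upE; apply/mnm_lepP => l; rewrite !mnmE; exact: ff'.
exists d => m Em; pose f j := if insub j is Some l then m l else 0%N.
have fE (l : 'I_n) : f l = m l by rewrite /f valK.
have /dP : U f.
  by apply: upE Em; apply/mnm_lepP => l; rewrite mnmE fE.
by apply: upE; apply/mnm_lepP => l; rewrite !mnmE fE.
Qed.

(** The sets S for which the localization at the product of the variables in S
    has a nonzero component in multidegree u: the coordinates in S can be
    raised at will, those outside S cannot. *)
Definition degree_family E u S : Prop :=
  exists2 m, E m & forall l, l \notin S -> (m l)%:Z <= u l.

Definition tdeg u : int := \sum_l u l.

Definition unitv i : {ffun 'I_n -> int} := [ffun l => (l == i)%:Z].

(** The values p + |u| whose maximum is the regularity. *)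
Definition reg_value E (r : int) : Prop :=
  exists p u, ~ acyclic_at k (degree_family E u) p /\ r = p%:Z + tdeg u.

Lemma degree_family_upset E u : upset (degree_family E u).
Proof.
move=> S T ST [m Em mu]; exists m => // l lT; apply: mu.
by apply: contra lT; apply: (subsetP ST).
Qed.

Lemma degree_family_full E u S : (forall l, u l < 0) -> (exists m, E m) ->
  degree_family E u S <-> S = setT.
Proof.
move=> u0 [m Em]; split=> [[m' _ mu]|->]; last by exists m => // l; rewrite inE.
apply/setP => l; rewrite inE; apply: contraT => lS.
by have := mu l lS; have := u0 l; lia.
Qed.

Lemma tdegD u v : tdeg (u + v) = tdeg u + tdeg v.
Proof. by rewrite /tdeg -big_split; apply: eq_bigr => l _; rewrite ffunE. Qed.

Lemma tdeg_unitv i : tdeg (unitv i) = 1.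
Proof.
rewrite /tdeg (bigD1 i) //= ffunE eqxx big1 ?addr0 // => l.
by rewrite ffunE => /negPf ->.
Qed.

Lemma tdegB u v : tdeg (u - v) = tdeg u - tdeg v.
Proof. by rewrite -[in RHS](subrK v u) [in RHS]tdegD addrK. Qed.

(** No set has more than n elements, and a coordinate u_l above d makes the
    family a cone with apex l. *)
Lemma reg_value_le E d r : truncates E d -> exp_ideal E -> reg_value E r ->
  r <= (n + n * d)%N%:Z.
Proof.
move=> dE upE [p [u [nac ->]]].
have pn : (p <= n)%N.
  rewrite leqNgt; apply/negP => np; apply: nac => f _ _.
  exists (fun=> 0) => [q _ S _ //|S cS].
  by have := max_card (mem S); rewrite cS card_ord leqNgt np.
have ud l : u l <= d%:Z.
  rewrite leNgt; apply/negP => dl; apply: nac; apply: (@cone_acyclic _ _ _ _ l).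
  move=> S [m Em mu]; exists [multinom minn (m x) d | x < n]; first exact: dE.
  move=> x; rewrite mnmE !inE negb_and negbK => /orP[/eqP ->|/mu]; lia.
suff : tdeg u <= (n * d)%N%:Z by lia.
apply: (@le_trans _ _ (\sum_(l < n) d%:Z)); first exact: ler_sum.
by rewrite sumr_const card_ord -mulr_natl PoszM natz.
Qed.

(** In multidegree (-1, ..., -1) only the full set survives, and its indicator
    is not a coboundary. *)
Lemma reg_value_ex E : (exists m, E m) -> exists r, reg_value E r.
Proof.
move=> exE; pose u : {ffun 'I_n -> int} := [ffun=> -1].
exists (n%:Z + tdeg u), n, u.
have famE S := @degree_family_full E u S (fun l => ltac:(by rewrite ffunE)) exE.
split=> // ac; have [S cS f0||g Fg] := ac (fun S => (S == setT)%:R).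
- by apply/famE/eqP; apply: contraPT f0 => /negPf ->; apply.
- move=> T cT; have := max_card (mem T); rewrite cT card_ord ltnn //.
move/(_ setT); rewrite cardsT card_ord eqxx => /(_ erefl)/esym gT.
have [|i iT gi] := @deltaN0 _ _ g setT.
  by rewrite gT; apply/eqP/oner_neq0.
have cT : #|[set: 'I_n]| = n by rewrite cardsT card_ord.
have [q nE] := card_setS cT iT.
have := Fg q nE _ (cardsD1P (etrans cT nE) iT) gi.
by move/famE/setP/(_ i); rewrite !inE eqxx.
Qed.

Lemma int_max (P : int -> Prop) b :
    (exists r, P r) -> (forall r, P r -> r <= b) ->
  exists2 r, P r & forall s, P s -> s <= r.
Proof.
move=> [r Pr] bP; have [d] := ubnP `|b - r|%N.
elim: d => // d IHd in r Pr *; move=> bd.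
have [[s Ps rs]|nex] := classic (exists2 s, P s & r < s).
  by apply: (IHd s Ps); have := bP _ Pr; have := bP _ Ps; lia.
exists r => // s Ps; rewrite leNgt; apply/negP => rs; apply: nex; by exists s.
Qed.

Lemma reg_value_max E : exp_ideal E -> (exists m, E m) ->
  exists2 r, reg_value E r & forall s, reg_value E s -> s <= r.
Proof.
move=> upE exE; have [d dE] := exp_ideal_truncates upE.
apply: int_max; first exact: reg_value_ex.
by move=> r; apply: reg_value_le dE upE.
Qed.

Section ColonPlus.

Variables (E : 'X_{1..n} -> Prop) (i : 'I_n).
Hypothesis upE : exp_ideal E.
Hypothesis exE : exists m, E m.

Definition exp_colon m := E (m + U_(i))%MM.
Definition exp_plus m := E m \/ (0 < m i)%N.

Lemma exp_colon_ideal : exp_ideal exp_colon.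
Proof.
move=> m m' /mnm_lepP mm'; apply: upE; apply/mnm_lepP => l.
by rewrite !mnmDE leq_add2r.
Qed.

Lemma exp_plus_ideal : exp_ideal exp_plus.
Proof.
move=> m m' mm' [Em|mi]; first by left; apply: upE Em.
by right; apply: leq_trans mi (mnm_lepP mm' i).
Qed.

Lemma degree_colon_neg u S : u i < 0 ->
  degree_family exp_colon u S <-> degree_family E u S.
Proof.
move=> ui; split=> -[m Em mu].
  exists (m + U_(i))%MM => // l lS; rewrite mnmDE mnm1E.
  case: eqP => [il|_]; last by rewrite addn0 mu.
  by have := mu l lS; rewrite -il in ui *; lia.
by exists m => //; apply: upE Em; apply: lem_addr.
Qed.

Lemma degree_colon_nneg u S : 0 <= u i ->
  degree_family exp_colon u S <-> degree_family E (u + unitv i) S.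
Proof.
move=> ui; split=> -[m Em mu].
  exists (m + U_(i))%MM => // l lS; rewrite mnmDE mnm1E !ffunE eq_sym.
  by have := mu l lS; case: eqP => _ /=; lia.
exists (m - U_(i))%MM.
  apply: upE Em; apply/mnm_lepP => l; rewrite mnmDE mnmBE; lia.
move=> l lS; rewrite mnmBE mnm1E; have := mu l lS; rewrite !ffunE eq_sym.
by case: eqP => [<-|_] /=; lia.
Qed.

Lemma degree_link u S : u i = 0 ->
  (i \in S /\ degree_family E u S) <-> degree_family E (u - unitv i) S.
Proof.
move=> ui; split=> [[iS [m Em mu]]|[m Em mu]].
  exists m => // l lS; have := mu l lS; rewrite !ffunE.
  by case: eqP lS => [->|_ _] /=; rewrite ?iS ?subr0.
split.
  by apply: contraT => iS; have := mu i iS; rewrite !ffunE eqxx ui /=; lia.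
exists m => // l lS; have := mu l lS; rewrite !ffunE; case: eqP => _ /=; lia.
Qed.

Lemma degree_sub_plus u S : degree_family E u S -> degree_family exp_plus u S.
Proof. by case=> m Em mu; exists m => //; left. Qed.

Lemma degree_plus_sub u S : u i = 0 -> i \notin S ->
  degree_family exp_plus u S -> degree_family E u S.
Proof.
move=> ui iS [m [Em|mi] mu]; first by exists m.
by have := mu i iS; rewrite ui; lia.
Qed.

(** The exponent of x_i alone shows that a set lies in the family of (I, x),
    provided that i is in the set or u_i > 0. *)
Lemma degree_plusD1 u S l : 0 <= u l -> (l = i -> 0 < u i) ->
    (l <> i -> i \in S) ->
  degree_family exp_plus u S -> degree_family exp_plus u (S :\ l).
Proof.
move=> ul li iS [m _ mu]; exists U_(i)%MM.
  by right; rewrite mnm1E eqxx.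
move=> x; rewrite !inE negb_and negbK mnm1E.
have [<-|_] := eqVneq i x; last first.
  by case/orP => [/eqP ->//|/mu]; lia.
have [il _|/eqP il /= iS'] := eqVneq i l; first by have := li (esym il); lia.
by rewrite iS // in iS' => /esym.
Qed.

Lemma reg_value_colon r : reg_value exp_colon r ->
  exists2 s, reg_value E s & r <= s.
Proof.
case=> p [u [nac ->]]; have [ui|ui] := ltP (u i) 0.
  exists (p%:Z + tdeg u) => //; exists p, u; split=> // ac; apply: nac.
  by apply: eq_acyclic ac => S; split=> /(degree_colon_neg _ ui).
exists (p%:Z + tdeg (u + unitv i)); last first.
  by rewrite tdegD tdeg_unitv; lia.
exists p, (u + unitv i); split=> // ac; apply: nac.
by apply: eq_acyclic ac => S; split=> /(degree_colon_nneg _ ui).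
Qed.

(** If u_i > 0 the family of (I, x) is a cone with apex i; if u_i < 0, or if
    u_i = 0 and i is in the set, a coordinate u_l >= 0 with l <> i can be
    dropped. So all coordinates but u_i are negative, only the full set and
    the complement of i are left, and the families agree on both. *)
Lemma degree_plus_eq u p : ~ acyclic_at k (degree_family exp_plus u) p ->
    (u i = 0 -> forall l, l != i -> u l < 0) ->
  forall S, degree_family exp_plus u S <-> degree_family E u S.
Proof.
move=> nac u0 S.
have ui : u i <= 0.
  rewrite leNgt; apply/negP => ui; apply: nac; apply: (@cone_acyclic _ _ _ _ i).
  by move=> T; apply: degree_plusD1 => //; apply: ltW.
have neg l : l != i -> u l < 0.
  move=> li; have [/u0 u0'|/eqP ui0] := eqVneq (u i) 0; first exact: u0'.
  rewrite ltNge; apply/negP => ul; apply: nac.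
  apply: (@cone_acyclic _ _ _ _ l) => T FT; apply: degree_plusD1 (FT) => //.
    by move/eqP; rewrite (negPf li).
  by move=> _; apply: contraT => iT; case: FT => m _ /(_ i iT); lia.
split; last exact: degree_sub_plus.
move=> FS; have [iS|iS] := boolP (i \in S); last first.
  apply: (degree_plus_sub _ _ (FS)) => //.
  by case: FS => m _ /(_ i iS); lia.
have [m Em] := exE; exists m => // l lS.
have li : l != i by apply: contraNneq lS => ->.
by have := neg l li; case: FS => m' _ /(_ l lS); lia.
Qed.

Lemma reg_value_plus r : reg_value exp_plus r -> reg_value E r.
Proof.
case=> p [u [nac ->]].
have [u0|nu0] := classic (u i = 0 -> forall l, l != i -> u l < 0).
  exists p, u; split=> // ac; apply: (nac); apply: eq_acyclic ac => S.
  by split=> /(degree_plus_eq nac u0).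
have {nu0}[ui [l [li ul]]] : u i = 0 /\ exists l, l != i /\ 0 <= u l.
  apply: NNPP => nex; apply: nu0 => ui l li; rewrite ltNge; apply/negP => ul.
  by apply: nex; split=> //; exists l.
have [aF|naF] := classic (acyclic_at k (degree_family E u) p); last first.
  by exists p, u.
exists p.+1, (u - unitv i); split; last by rewrite tdegB tdeg_unitv; lia.
move=> aL; apply: nac.
apply: (acyclic_of_smaller _ _ _ _ (l := l) aF).
- exact: degree_family_upset.
- exact: degree_sub_plus.
- by move=> S; apply: degree_plus_sub.
- move=> S iS; apply: degree_plusD1 => //.
  by move/eqP; rewrite (negPf li).
by apply: eq_acyclic aL => S; split=> /(degree_link _ ui).
Qed.

Lemma reg_value_split r : reg_value E r ->
  [\/ reg_value exp_plus r, reg_value exp_colon r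
    | reg_value exp_colon (r - 1)].
Proof.
case=> p [u [nac ->]]; have [ui|ui] := ltP (u i) 0.
  apply: Or32; exists p, u; split=> // ac; apply: nac.
  by apply: eq_acyclic ac => S; split=> /(degree_colon_neg _ ui).
have [ui'|ui'] := eqVneq (u i) 0.
  have [aG|naG] := classic (acyclic_at k (degree_family exp_plus u) p);
    last first.
    by apply: Or31; exists p, u.
  apply: Or33; exists p, (u - unitv i).
  split; last by rewrite tdegB tdeg_unitv; lia.
  move=> aL; apply: nac; apply: (acyclic_of_larger _ _ _ aG).
  - exact: degree_family_upset.
  - exact: degree_sub_plus.
  - by move=> S; apply: degree_plus_sub.
  apply: eq_acyclic aL => S; rewrite (degree_link _ ui') degree_colon_neg //.
  by rewrite !ffunE eqxx ui' /=; lia.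
apply: Or33; exists p, (u - unitv i).
split; last by rewrite tdegB tdeg_unitv; lia.
move=> ac; apply: nac; apply: eq_acyclic ac => S.
rewrite degree_colon_nneg ?subrK // !ffunE eqxx /=; lia.
Qed.

End ColonPlus.
End DegreeFamily.

(** * Multigraded coefficients *)

Section Multidegree.

Variables (k : fieldType) (n : nat).
Local Notation R := {mpoly k[n]}.
Implicit Types (f g : R) (m w : 'X_{1..n}) (u v : {ffun 'I_n -> int})
  (S T : {set 'I_n}) (i l : 'I_n).

Definition zexp m : {ffun 'I_n -> int} := [ffun l => (m l)%:Z].

Definition ind S : {ffun 'I_n -> int} := [ffun l => (l \in S)%:Z].

Definition zcoef f v : k :=
  if [forall l, 0 <= v l] then f@_[multinom `|v l|%N | l < n] else 0.

Lemma zexp_surj v :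
  (forall l, 0 <= v l) -> zexp [multinom `|v l|%N | l < n] = v.
Proof. by move=> v0; apply/ffunP => l; rewrite ffunE mnmE gez0_abs. Qed.

Lemma zexpD m w : zexp (m + w)%MM = zexp m + zexp w.
Proof. by apply/ffunP => l; rewrite !ffunE mnmDE PoszD. Qed.

Lemma zexpMn m a : zexp (m *+ a)%MM = zexp m *+ a.
Proof.
elim: a => [|a IHa]; first by apply/ffunP => l; rewrite !ffunE mnm0E.
by rewrite mulmSr zexpD IHa mulrSr.
Qed.

Lemma zexp_inj : injective zexp.
Proof.
move=> m w /ffunP mw; apply/mnmP => l.
by have := mw l; rewrite !ffunE => -[].
Qed.

Lemma tdeg_zexp m : tdeg (zexp m) = (mdeg m)%:Z.
Proof.
rewrite mdegE (big_morph Posz PoszD (erefl _)).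
by apply: eq_bigr => l _; rewrite ffunE.
Qed.

Lemma zcoef_zexp f m : zcoef f (zexp m) = f@_m.
Proof.
rewrite /zcoef; case: forallP => [_|[]]; last by move=> l; rewrite ffunE.
by congr (_@__); apply/mnmP => l; rewrite mnmE ffunE.
Qed.

Lemma zcoefN0 f v : zcoef f v <> 0 -> exists2 m, m \in msupp f & v = zexp m.
Proof.
rewrite /zcoef; case: forallP => [v0 /eqP fN0|_]; last by [].
exists [multinom `|v l|%N | l < n]; last by rewrite zexp_surj.
by rewrite mcoeff_msupp.
Qed.

Lemma zcoef_inj f g : zcoef f =1 zcoef g -> f = g.
Proof. by move=> fg; apply/mpolyP => m; rewrite -!zcoef_zexp. Qed.

Lemma zcoef0 v : zcoef 0 v = 0.
Proof. by rewrite /zcoef mcoeff0 if_same. Qed.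

Lemma zcoefD f g v : zcoef (f + g) v = zcoef f v + zcoef g v.
Proof. by rewrite /zcoef; case: ifP => _; rewrite ?mcoeffD ?addr0. Qed.

Lemma zcoef_sum (J : Type) (r : seq J) (P : pred J) (F : J -> R) v :
  zcoef (\sum_(j <- r | P j) F j) v = \sum_(j <- r | P j) zcoef (F j) v.
Proof.
by apply: (big_morph (zcoef^~ v)) => [f g|]; rewrite (zcoefD, zcoef0).
Qed.

Lemma zcoefZ a f v : zcoef (a *: f) v = a * zcoef f v.
Proof. by rewrite /zcoef; case: ifP => _; rewrite ?mcoeffZ ?mulr0. Qed.

Lemma zcoefX m v : zcoef 'X_[m] v = (v == zexp m)%:R.
Proof.
have [->|vm] := eqVneq v (zexp m); first by rewrite zcoef_zexp mcoeffX eqxx.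
have [//|/eqP/zcoefN0[w]] := eqVneq (zcoef 'X_[m] v) 0.
by rewrite msuppX inE => /eqP -> vE; rewrite vE eqxx in vm.
Qed.

(** Extension by zero to Z^n makes multiplication by a monomial a plain shift,
    with no side condition on exponents. *)
Lemma zcoefXM w f v : zcoef ('X_[w] * f) v = zcoef f (v - zexp w).
Proof.
rewrite [f in LHS]mpolyE [f in RHS]mpolyE mulr_sumr !zcoef_sum.
apply: eq_bigr => m _; rewrite -scalerAr -mpolyXD !zcoefZ !zcoefX zexpD.
by rewrite subr_eq addrC.
Qed.

Lemma xprodE S : xprod k S = 'X_[[multinom (l \in S : nat) | l < n]].
Proof.
rewrite mpolyXE_id /xprod big_mkcond; apply: eq_bigr => l _.
by rewrite mnmE; case: (l \in S).
Qed.

Lemma zcoef_xprodM S a f v :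
  zcoef (xprod k S ^+ a * f) v = zcoef f (v - ind S *+ a).
Proof.
rewrite xprodE mpolyXn zcoefXM zexpMn; congr (zcoef f (_ - _ *+ a)).
by apply/ffunP => l; rewrite !ffunE mnmE.
Qed.

Lemma zcoef_XM i a f v : zcoef ('X_i ^+ a * f) v = zcoef f (v - unitv i *+ a).
Proof.
have -> : 'X_i = xprod k [set i] :> R by rewrite /xprod big_set1.
rewrite zcoef_xprodM; congr (zcoef f (_ - _ *+ a)).
by apply/ffunP => l; rewrite !ffunE inE.
Qed.

Lemma indD1 T i : i \in T -> ind T = ind (T :\ i) + unitv i.
Proof.
move=> iT; apply/ffunP => l; rewrite !ffunE !inE.
by case: eqP => [->|]; rewrite ?iT ?addr0.
Qed.

Lemma ind_mulrnE S a l : (ind S *+ a) l = (a * (l \in S))%N%:Z.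
Proof.
elim: a => [|a IHa]; first by rewrite mulr0n ffunE.
by rewrite mulrSr !ffunE IHa mulSn addnC.
Qed.

Lemma tdeg_ind S a : tdeg (ind S *+ a) = (a * #|S|)%N%:Z.
Proof.
rewrite /tdeg -sum1_card big_distrr (big_morph Posz PoszD (erefl _)) /=.
rewrite [RHS]big_mkcond; apply: eq_bigr => l _; rewrite ind_mulrnE.
by case: (l \in S); rewrite ?muln0.
Qed.

End Multidegree.
Arguments ind {n}.

(** * Local cohomology in a multidegree *)

Section Cech.

Variables (k : fieldType) (n : nat) (I : {mpoly k[n]} -> Prop).
Local Notation R := {mpoly k[n]}.
Implicit Types (f g : R) (m w : 'X_{1..n}) (u v : {ffun 'I_n -> int})
  (S T : {set 'I_n}) (i l : 'I_n) (c e : {set 'I_n} -> R^o).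

(** The component in multidegree u of the fraction c S / xprod S ^+ a. *)
Definition zpart a c u S : k := zcoef (c S : R) (u + ind S *+ a).

Lemma frac_eqP S (f g : R^o) a b :
  frac_eq S f a g b <-> xprod k S ^+ b * (f : R) = xprod k S ^+ a * (g : R).
Proof.
have xN0 t : xprod k S ^+ t != 0 by rewrite xprodE mpolyXn -msupp_eq0 msuppX.
split=> [[t]|fg].
  change (xprod k S ^+ t * (xprod k S ^+ b * f - xprod k S ^+ a * g) = 0 ->
    xprod k S ^+ b * f = xprod k S ^+ a * g).
  by move/eqP; rewrite mulf_eq0 (negPf (xN0 t)) /= subr_eq0 => /eqP.
exists 0%N.
change (xprod k S ^+ 0 * (xprod k S ^+ b * f - xprod k S ^+ a * g) = 0).
by rewrite fg subrr mulr0.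
Qed.

Lemma zpart_cech_diff a c u : zpart a (cech_diff a c) u =1 delta (zpart a c u).
Proof.
move=> T; rewrite /zpart /cech_diff zcoef_sum; apply: eq_bigr => i iT.
have -> : (-1) ^+ #|[set l in T | (l < i)%N]| *: ('X_i ^+ a *: c (T :\ i)) =
    sgn k T i *: ('X_i ^+ a * (c (T :\ i) : R)) :> R.
  by rewrite -mul_mpolyC rmorphXn rmorphN1.
rewrite zcoefZ zcoef_XM (indD1 iT) mulrnDl addrA addrK //.
Qed.

(** Fractions are determined by their multigraded components; the base ring
    being a domain, no power of the denominator is needed to compare them. *)
Lemma frac_zpart S c a e b :
  frac_eq S (c S) a (e S) b <-> forall u, zpart a c u S = zpart b e u S.
Proof.
rewrite frac_eqP; split=> [ce u|ce].
  have := congr1 (fun g : R => zcoef g (u + ind S *+ (a + b))) ce.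
  by rewrite !zcoef_xprodM mulrnDr addrA addrK (addrAC u) addrK.
apply: zcoef_inj => v; rewrite !zcoef_xprodM.
have := ce (v - ind S *+ (a + b)); rewrite /zpart mulrnDr => eqv.
by move: eqv; rewrite opprD addrA addrAC !subrK addrAC subrK.
Qed.

Lemma zpart0 a u S : zpart a (fun=> 0) u S = 0.
Proof. exact: zcoef0. Qed.

Lemma cech_cocycleP p a c :
  cech_cocycle p a c <-> forall u, cocycle p (zpart a c u).
Proof.
split=> [cc u T cT|cc T cT].
  rewrite -zpart_cech_diff -(zpart0 0 u T); move: (cc T cT) u.
  by rewrite (@frac_zpart _ _ _ (fun=> 0)).
apply/(@frac_zpart _ _ _ (fun=> 0)) => u.
by rewrite zpart_cech_diff zpart0 cc.
Qed.

Definition has_exponents (E : 'X_{1..n} -> Prop) : Prop :=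
  forall f, I f <-> forall m, m \in msupp f -> E m.

Variable E : 'X_{1..n} -> Prop.
Hypothesis upE : exp_ideal E.
Hypothesis IE : has_exponents E.

Lemma zpart_supported p j a c u : cech_cochain (ideal_component I) p j a c ->
  supported (degree_family E u) p (zpart a c u).
Proof.
move=> cI S cS /zcoefN0[m mc /ffunP uE]; exists m.
  by case: (cI S cS) => /IE/(_ m mc).
move=> l /negPf lS; have := uE l.
by rewrite !ffunE ind_mulrnE lS muln0 addr0 => ->.
Qed.

(** A uniform exponent a + d of the denominators realizes all the members of
    all the families of the multidegrees bounded below by - a. This is what
    allows finitely many multidegrees to be handled with one denominator. *)
Lemma degree_family_exp d u S a : truncates E d -> (forall l, - a%:Z <= u l) ->
  degree_family E u S -> exists2 m, E m & zexp m = u + ind S *+ (a + d).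
Proof.
move=> dE ua [m Em mu]; set v := u + _.
have vE l : v l = u l + ((a + d) * (l \in S))%N%:Z.
  by rewrite ffunE ind_mulrnE.
have v0 l : 0 <= v l.
  rewrite vE; move: (ua l) (mu l).
  by case: (l \in S) => /= [|? /(_ erefl)]; lia.
exists [multinom `|v l|%N | l < n]; last by rewrite zexp_surj.
apply: upE (dE _ Em); apply/mnm_lepP => l; rewrite !mnmE vE.
by move: (ua l) (mu l); case: (l \in S) => /= [|? /(_ erefl)]; lia.
Qed.

Lemma bounded_below u : exists a : nat, forall l, - a%:Z <= u l.
Proof.
exists (\max_l `|u l|)%N => l.
have : (`|u l| <= \max_l `|u l|)%N by apply: leq_bigmax.
lia.
Qed.

(** A cocycle f on the family of u is turned into the Cech cocycle of the
    fractions f S * x^u, and a Cech primitive of it would have a component of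
    multidegree u that is a primitive of f. *)
Lemma local_cohomology_of_degree p u : ~ acyclic_at k (degree_family E u) p ->
  local_cohomology_neq0 (ideal_component I) p (tdeg u).
Proof.
case/not_acyclicP => f [Ff cf nf].
have [d dE] := exp_ideal_truncates upE.
have [a0 ua0] := bounded_below u; pose a := (a0 + d)%N.
pose mon S := [multinom `|(u + ind S *+ a)%R l|%N | l < n].
pose c S : R^o := f S *: 'X_[mon S].
have monE S : degree_family E u S -> E (mon S) /\ zexp (mon S) = u + ind S *+ a.
  case/(degree_family_exp dE ua0) => m Em mE; suff -> : mon S = m by [].
  by apply: zexp_inj; rewrite zexp_surj -?mE // => l; rewrite ffunE.
have cE v S : #|S| = p -> zpart a c v S = f S * (v == u)%:R.
  move=> cS; rewrite /zpart zcoefZ zcoefX.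
  have [->|/eqP/(Ff S cS)/monE[_ ->]] := eqVneq (f S) 0.
    by rewrite !mul0r.
  by rewrite (inj_eq (addIr _)).
exists a, c; split.
- move=> S cS; have [f0|/eqP/(Ff S cS)/monE[Em mE]] := eqVneq (f S) 0.
    by rewrite /c f0 scale0r; split; [apply/IE|]; move=> m; rewrite msupp0.
  split; first by apply/IE => m /msuppZ_le; rewrite msuppX inE => /eqP ->.
  move=> m /msuppZ_le; rewrite msuppX inE => /eqP ->.
  by rewrite -tdeg_zexp mE tdegD tdeg_ind cS.
- apply/cech_cocycleP => v T cT; have [->|vu] := eqVneq v u.
    rewrite -[RHS](cf T cT); apply: eq_delta => i iT.
    by rewrite cE ?eqxx ?mulr1 //; apply: cardsD1P iT.
  apply: big1 => i iT.
  by rewrite cE ?(negPf vu) ?mulr0 //; apply: cardsD1P iT.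
have fE S : #|S| = p -> f S = zpart a c u S.
  by move=> cS; rewrite cE // eqxx mulr1.
move=> cob; apply: nf; case: p => [|q] in Ff cf cE fE cob *.
  exists (fun=> 0) => // S cS; rewrite fE //; have := cob S cS.
  move/(@frac_zpart _ _ _ (fun=> 0)) => ->.
  by rewrite zpart0 /delta big1 // => i _; apply: mulr0.
case: cob => b [e [eI ce]].
exists (zpart b e u) => [_ [<-]|S cS]; first exact: zpart_supported eI.
by rewrite fE // -zpart_cech_diff; have/frac_zpart -> := ce S cS.
Qed.

(** If all multidegrees of total degree j are acyclic, the finitely many nonzero
    components of a Cech cocycle have primitives, and these are put together
    over a common denominator. *)
Lemma degree_of_local_cohomology p j :
    local_cohomology_neq0 (ideal_component I) p j ->
  exists2 u, tdeg u = j & ~ acyclic_at k (degree_family E u) p.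
Proof.
case=> a [c [cI cc ncob]]; apply: NNPP => nex; apply: ncob.
have ac u : tdeg u = j -> coboundary (degree_family E u) p (zpart a c u).
  move=> uj; have acu : acyclic_at k (degree_family E u) p.
    by apply: NNPP => nac; apply: nex; exists u.
  apply: acu; first exact: zpart_supported cI.
  exact: (cech_cocycleP p a c).1.
have [h hP] : exists h : {ffun 'I_n -> int} -> {set 'I_n} -> k,
    forall u, tdeg u = j ->
    (forall q, p = q.+1 -> supported (degree_family E u) q (h u)) /\
    forall S, #|S| = p -> zpart a c u S = delta (h u) S.
  pose P u (g : {set 'I_n} -> k) := tdeg u = j ->
    (forall q, p = q.+1 -> supported (degree_family E u) q g) /\
    forall S, #|S| = p -> zpart a c u S = delta g S.
  have exP u : exists g : {set 'I_n} -> k, P u g.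
    have [uj|] := classic (tdeg u = j); last by exists (fun=> 0).
    by case: (ac u uj) => g Fg gE; exists g.
  exists (fun u =>
    proj1_sig (constructive_indefinite_description _ (exP u))) => u.
  exact: (proj2_sig (constructive_indefinite_description _ (exP u))).
case: p {nex} => [|q] in cI cc ac hP *.
  move=> S S0; apply/(@frac_zpart _ _ _ (fun=> 0)) => u; rewrite zpart0.
  have [//|/eqP/zcoefN0[m mc uE]] := eqVneq (zpart a c u S) 0.
  have [|_ ->//] := hP u.
    have := congr1 (@tdeg n) uE.
    rewrite tdegD tdeg_ind S0 muln0 addr0 tdeg_zexp.
    by case: (cI S S0) => _ /(_ m mc) ->; rewrite muln0 addr0.
  by rewrite /delta (eqP (_ : S == set0)) ?big_set0 // -cards_eq0 S0.
(* the multidegrees in which some component of c is nonzero *)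
pose U := undup [seq zexp m - ind T *+ a
  | T <- enum [set T : {set 'I_n} | #|T| == q.+1], m <- msupp (c T : R)].
have UP u : u \in U -> tdeg u = j /\ forall l, - a%:Z <= u l.
  rewrite mem_undup => /allpairsPdep[S [m [SS mc ->]]]; split.
    move: SS; rewrite mem_enum inE => /eqP cS.
    rewrite tdegB tdeg_zexp tdeg_ind cS.
    by case: (cI S cS) => _ /(_ m mc) ->; rewrite addrK.
  by move=> l; rewrite !ffunE ind_mulrnE; case: (l \in S) => /=; lia.
have UN u S : #|S| = q.+1 -> u \notin U -> zpart a c u S = 0.
  move=> cS; apply: contraNeq => /eqP/zcoefN0[m mc uE].
  rewrite mem_undup; apply/allpairsPdep; exists S, m.
  by rewrite mem_enum inE cS -uE addrK.
have [d dE] := exp_ideal_truncates upE; pose b := (a + d)%N.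
pose mon u S := [multinom `|(u + ind S *+ b)%R l|%N | l < n].
pose e S : R^o := \sum_(u <- U) h u S *: 'X_[mon u S].
have eE S u : #|S| = q -> zpart b e u S = if u \in U then h u S else 0.
  move=> cS; rewrite /zpart zcoef_sum.
  have monE v : v \in U -> h v S <> 0 -> zexp (mon v S) = v + ind S *+ b.
    move=> /UP[vj va] hN0; have [/(_ q erefl S cS hN0) Fv _] := hP v vj.
    have [m _ mE] := degree_family_exp dE va Fv.
    by rewrite zexp_surj // -mE => l; rewrite ffunE.
  have termE v : v \in U -> zcoef (h v S *: 'X_[mon v S]) (u + ind S *+ b) =
      if v == u then h v S else 0.
    move=> vU; rewrite zcoefZ zcoefX.
    have [->|/eqP hN0] := eqVneq (h v S) 0; first by rewrite mul0r if_same.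
    rewrite monE // (inj_eq (addIr _)) eq_sym.
    by case: eqP; rewrite ?mulr1 ?mulr0.
  rewrite (eq_big_seq _ termE) -big_mkcond /=.
  case: ifPn => uU; last first.
    rewrite big_seq_cond big1 // => v /andP[vU /eqP vu].
    by rewrite -vu vU in uU.
  by rewrite -big_filter filter_pred1_uniq ?undup_uniq // big_seq1.
exists b, e; split=> [S cS|S cS].
  have supp_e m :
      m \in msupp (e S : R) -> E m /\ (mdeg m)%:Z = j + (b * q)%N%:Z.
    rewrite mcoeff_msupp -zcoef_zexp -(subrK (ind S *+ b) (zexp m)).
    have := eE S (zexp m - ind S *+ b) cS; rewrite /zpart => ->.
    set u := _ - _; case: ifP => [/UP[uj ua] /eqP hN0|]; last by rewrite eqxx.
    have [/(_ q erefl S cS hN0) Fv _] := hP u uj.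
    have [m' Em' mE] := degree_family_exp dE ua Fv.
    have m'm : m' = m by apply: zexp_inj; rewrite mE subrK.
    split; first by rewrite -m'm.
    by rewrite -tdeg_zexp -uj -cS -tdeg_ind -tdegD subrK.
  by split; [apply/IE => m /supp_e[]|move=> m /supp_e[]].
apply/frac_zpart => u; rewrite zpart_cech_diff.
have [uU|uU] := boolP (u \in U).
  have [_ ->//] := hP u (UP u uU).1; apply: eq_delta => i iT.
  by rewrite eE ?uU //; apply: cardsD1P iT.
rewrite UN // /delta big1 // => i iT.
by rewrite eE ?(negPf uU) ?mulr0 //; apply: cardsD1P iT.
Qed.

Lemma reg_idealP : (exists m, E m) ->
  reg_value k E (reg_ideal I) /\ forall r, reg_value k E r -> r <= reg_ideal I.
Proof.
move=> exE; have [r Er r_max] := reg_value_max k upE exE.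
suff -> : reg_ideal I = r by [].
apply: regE; split=> [|p j /degree_of_local_cohomology[u uj nac]].
  have [p [u [nac ->]]] := Er; exists p, (tdeg u); split=> //.
  exact: local_cohomology_of_degree.
by apply: r_max; exists p, u; rewrite uj.
Qed.

End Cech.

(** * Exponents of monomial ideals *)

Section MonomialIdeals.

Variables (k : fieldType) (n : nat).
Local Notation R := {mpoly k[n]}.
Implicit Types (I : R -> Prop) (E : 'X_{1..n} -> Prop) (f g : R).

Lemma sum_of_terms (J : R -> Prop) f :
    J 0 -> (forall g h, J g -> J h -> J (g + h)) ->
  (forall m, m \in msupp f -> J (f@_m *: 'X_[m])) -> J f.
Proof.
by move=> J0 JD JX; rewrite (mpolyE f) big_seq; apply: (big_ind J).
Qed.

Lemma monomial_ideal_exponents I : monomial_ideal I ->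
  exists2 E, exp_ideal E & has_exponents I E.
Proof.
case=> A IA; exists (fun m => exists2 w, A w & (w <= m)%MM).
  by move=> m m' mm' [w Aw wm]; exists w => //; apply: lepm_trans mm'.
move=> f; split=> [/IA If|fE]; last first.
  apply/IA => J [J0 JD JM] JA; apply: sum_of_terms => // m /fE[w Aw wm].
  by rewrite -mul_mpolyC -(submK wm) mpolyXD mulrA; apply/JM/JA; exists w.
apply: (If (fun f => forall m, m \in msupp f -> exists2 w, A w & (w <= m)%MM)).
  split=> [m|g h gA hA m|h g gA m]; first by rewrite msupp0.
    by move/msuppD_le; rewrite mem_cat => /orP[/gA|/hA].
  move/msuppM_le/allpairsP=> [[m1 m2] /= [_ /gA[w Aw wm] ->]]; exists w => //.
  by apply: lepm_trans wm _; apply: lem_addl.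
move=> _ [w Aw ->] m; rewrite msuppX inE => /eqP ->.
by exists w => //; apply: lepm_refl.
Qed.

Lemma colon_exponents I E (i : 'I_n) : has_exponents I E ->
  has_exponents (colon_ideal I 'X_i) (exp_colon E i).
Proof.
move=> IE f; rewrite /colon_ideal IE.
have suppE m :
  (m \in msupp (f * 'X_i)) = (m \in [seq (U_(i) + m')%MM | m' <- msupp f]).
  exact/perm_mem/msuppMX.
split=> fE m.
  by move=> mf; apply: fE; rewrite suppE addmC; apply: map_f.
by rewrite suppE => /mapP[m' /fE Em' ->]; rewrite addmC.
Qed.

Lemma plus_exponents I E (i : 'I_n) : has_exponents I E ->
  has_exponents (ideal_sum I (principal_ideal 'X_i)) (exp_plus E i).
Proof.
move=> IE f; split=> [[g [_ [/IE gE [h ->] ->]]] m|fE].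
  move/msuppD_le; rewrite mem_cat => /orP[/gE|]; first by left.
  rewrite (perm_mem (msuppMX _ _)) => /mapP[m' _ ->].
  by right; rewrite mnmDE mnm1E eqxx.
have I0 : I 0 by apply/IE => m; rewrite msupp0.
have ID g h : I g -> I h -> I (g + h).
  move=> /IE gE /IE hE; apply/IE => m /msuppD_le.
  by rewrite mem_cat => /orP[/gE|/hE].
apply: sum_of_terms.
- by exists 0, 0; split; rewrite ?addr0 //; exists 0; rewrite mul0r.
- move=> _ _ [g1 [_ [Ig1 [h1 ->] ->]]] [g2 [_ [Ig2 [h2 ->] ->]]].
  exists (g1 + g2), ((h1 + h2) * 'X_i); split; first exact: ID.
    by exists (h1 + h2).
  by rewrite mulrDl addrACA.
move=> m /fE[Em|mi].
  exists (f@_m *: 'X_[m]), 0; split; last by rewrite addr0.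
    by apply/IE => m' /msuppZ_le; rewrite msuppX inE => /eqP ->.
  by exists 0; rewrite mul0r.
exists 0, (f@_m *: 'X_[m]); split; rewrite ?add0r //.
exists (f@_m *: 'X_[m - U_(i)]); rewrite -scalerAl -mpolyXD submK //.
by apply/mnm_lepP => l; rewrite mnm1E; case: eqP => [<-|].
Qed.

End MonomialIdeals.

Theorem corollary4p8 (k : fieldType) (n : nat) (I : {mpoly k[n]} -> Prop)
    (i : 'I_n) (I_monomial : monomial_ideal I)
    (I_neq0 : exists2 f, I f & f <> 0) :
  let x : {mpoly k[n]} := 'X_i in
  let I_colon_x := colon_ideal I x in
  let I_plus_x := ideal_sum I (principal_ideal x) in
  (Num.max (reg_ideal I_colon_x) (reg_ideal I_plus_x) <= reg_ideal I) /\
  (reg_ideal I <= Num.max (reg_ideal I_colon_x + 1) (reg_ideal I_plus_x)).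
Proof.
have [E upE IE] := monomial_ideal_exponents I_monomial; move=> x Ic Ip.
have exE : exists m, E m.
  have [f /IE fE fN0] := I_neq0; exists (mlead f); apply: fE.
  exact/mlead_supp/eqP.
have [m0 Em0] := exE.
have [I_val I_max] := reg_idealP upE IE exE.
have [|c_val c_max] :=
  reg_idealP (exp_colon_ideal (i := i) upE) (colon_exponents i IE).
  by exists m0; apply: upE Em0; apply: lem_addr.
have [|p_val p_max] :=
  reg_idealP (exp_plus_ideal (i := i) upE) (plus_exponents i IE).
  by exists m0; left.
split; rewrite ?ge_max ?le_max.
  apply/andP; split; last by apply: I_max; apply: (reg_value_plus exE p_val).
  by have [s /I_max sI] := reg_value_colon upE c_val; move/le_trans; apply.
have [/p_max ->|/c_max le_c|/c_max le_c] := reg_value_split i upE I_val.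
- by rewrite orbT.
- by rewrite (le_trans le_c) // lerDl.
by rewrite -lerBlDr le_c.
Qed.
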